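(* Let $X,Y$ be jointly distributed real random variables (each discrete or continuous). The conditional expectation $E[Y\mid X=x]$ can be approximated by a linear combination of the orthonormal LP score functions $\{T_j(X;X)\}_{1\le j\le m}$ with coefficients defined as $$E\big[E[Y\mid X]\,T_j(X;X)\big]=E[Y\,T_j(X;X)]=\mathrm{LP}(j,0;X,Y),$$ because of the representation $$E[Y\mid X=x]-E[Y]=\sum_{j>0}T_j(x;X)\,\mathrm{LP}(j,0;X,Y).$$
   Context: For the real random variable $X$, discrete or continuous, put $F(x;X)=\Pr[X\le x]$, $p(x;X)=\Pr[X=x]$, and define the mid-distribution function $F^{\mathrm{mid}}(x;X)=F(x;X)-\tfrac12 p(x;X)$. LP score functions: $T_0(x;X)=1$ and $T_1(x;X)=\dfrac{F^{\mathrm{mid}}(x;X)-\frac12}{\sigma(F^{\mathrm{mid}}(X;X))}$, where $\sigma$ denotes standard deviation (one has $E[F^{\mathrm{mid}}(X;X)]=\frac12$); $X$ is non-degenerate, so that $T_1$ is defined. The functions $T_j(\cdot;X)$, $j=0,1,2,\dots$, are obtained by Gram–Schmidt orthonormalization of the powers of $T_1(x;X)$, with respect to the distribution of $X$. If $X$ takes only $K<\infty$ values, the orthonormalization yields only $T_0,\dots,T_{K-1}$, and the sum over $j>0$ runs over the existing indices. The numbers $\mathrm{LP}(j,0;X,Y)=E[Y\,T_j(X;X)]$ are called zero-order LP comoments.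
   Formalization: Y is assumed integrable; for X with infinitely many values, E[Y|X] is also assumed square-integrable, and the representation is read as mean-square convergence plus convergence at each x with Pr[X=x]>0 (it fails in mean square for X uniform, Y=X^{-1/2}). *)

(* Defs.v *)
(* MathComp-Analysis *)
From HB Require Import structures.
From mathcomp Require Import all_boot all_order all_algebra.
From mathcomp Require Import all_classical all_reals all_analysis.

Set Implicit Arguments.
Unset Strict Implicit.
Unset Printing Implicit Defensive.

Import Order.TTheory GRing.Theory Num.Theory.
Import numFieldNormedType.Exports.

Local Open Scope classical_set_scope.
Local Open Scope ring_scope.

Section RandomVariables.
Context d (T : measurableType d) (R : realType) (P : probability T R).
Implicit Types X Y : {RV P >-> R}.

(* Discreteness is a property of the law: [X] may leave [C] on a null set. *)
Definition discrete_law X : Prop :=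
  exists2 C : set R, countable C & P (X @^-1` C) = 1%E.

Definition continuous_law X : Prop := continuous (cdf X).

Definition nondegenerate_law X : Prop :=
  forall c : R, P (X @^-1` [set c]) <> 1%E.

(* Up to a null set, [X] takes exactly [size s] values, listed in [s]. *)
Definition takes_values X (s : seq R) : Prop :=
  [/\ uniq s, (forall x, x \in s -> 0 < pmf X x)
    & P (X @^-1` [set` s]) = 1%E].

(* [r] is a version of the function [x |-> E[Y | X = x]], for integrable [Y]. *)
Definition cond_mean X Y (r : R -> R) : Prop :=
  [/\ measurable_fun [set: R] r,
      P.-integrable [set: T] (fun w => (r (X w))%:E)
    & forall B : set R, measurable B ->
        (\int[P]_(w in X @^-1` B) (r (X w))%:E
         = \int[P]_(w in X @^-1` B) (Y w)%:E)%E].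

Definition mid_cdf X (x : R) : R := fine (cdf X x) - 2^-1 * pmf X x.

Definition mid_sd X : R := Num.sqrt (fine ('V_P[mid_cdf X \o X])%E).

Definition lp_score1 X (x : R) : R := (mid_cdf X x - 2^-1) / mid_sd X.

Definition law_dot X (f g : R -> R) : R :=
  fine ('E_P[fun w => (f (X w) * g (X w))%R])%E.

Definition gs_residual X (fs : seq (R -> R)) (h : R -> R) : R -> R :=
  fun x => h x - \sum_(f <- fs) law_dot X h f * f x.

Definition gs_normalize X (g : R -> R) : R -> R :=
  fun x => g x / Num.sqrt (law_dot X g g).

(* The first [n] functions obtained by Gram-Schmidt from
   [1, lp_score1 X, lp_score1 X ^ 2, ...]; as [lp_score1 X] has mean 0 and
   variance 1 under the law of [X], the first two are [1] and [lp_score1 X]. *)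
Fixpoint lp_scores X (n : nat) : seq (R -> R) :=
  if n is m.+1 then
    rcons (lp_scores X m)
      (gs_normalize X
         (gs_residual X (lp_scores X m) (fun x => lp_score1 X x ^+ m)))
  else [::].

Definition lp_score X (j : nat) : R -> R :=
  nth (fun=> 0) (lp_scores X j.+1) j.

(* When [X] takes only [K] values, the score functions are those with [j < K];
   [lp_score X j] is meaningless (a division by a zero norm) for [K <= j]. *)
Definition lp_index X (j : nat) : Prop :=
  forall s, takes_values X s -> (j < size s)%N.

(* The zero-order LP comoment LP(j, 0; X, Y). *)
Definition lp_comoment0 X Y (j : nat) : R :=
  fine ('E_P[fun w => (Y w * lp_score X j (X w))%R])%E.

End RandomVariables.

(* Main.v *)
Require Import Defs.
From HB Require Import structures.
From mathcomp Require Import all_boot all_order all_algebra.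
From mathcomp Require Import all_classical all_reals all_analysis.
From mathcomp Require Import measurable_realfun ring lra.

Set Implicit Arguments.
Unset Strict Implicit.
Unset Printing Implicit Defensive.

Import Order.TTheory GRing.Theory Num.Theory.
Import numFieldNormedType.Exports.

Local Open Scope classical_set_scope.
Local Open Scope ring_scope.

(* The score functions T_j are polynomials of degree j in the bounded function
   T_1, and a bounded function g satisfies E[r(X) g(X)] = E[Y g(X)]; hence the
   comoments LP(j, 0; X, Y) are the Fourier coefficients of r in the orthonormal
   system (T_j), and the representation amounts to the density of the
   polynomials in T_1 in L^2 of the law of X.

   The mid-distribution function is nondecreasing, and injective off a null
   set.  Consequently:
   - a nonzero polynomial of degree n in T_1 that vanishes almost surely forces
     X to take at most n values, so Gram-Schmidt does not break down at the
     existing indices;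
   - up to a null set, the indicator of X > x is that of T_1(X) > T_1(x), a
     bounded pointwise limit of polynomials in T_1, because the iterates of
     u |-> (3 u - u ^ 3) / 2 converge to the sign function on [-1, 1].
   A pi-lambda argument and approximation by simple functions then give density.
   When X takes finitely many values, r agrees on them with an interpolating
   polynomial in T_1 and the expansion is exact. *)

(** * Dominated approximation by simple functions *)

Section SimpleApproximation.
Context d (T : measurableType d) (R : realType).
Import HBNNSimple.

(** The positive and negative parts have increasing simple approximations [p n] and [q n], and
    [p n - q n] is dominated by the sum of the two parts, which is the absolute value of [f]. The
    bound is what lets dominated convergence carry a property of indicators to general functions. *)
Lemma dominated_simple_approx (H : (T -> R) -> Prop) :
  H (cst 0) ->
  (forall (B : set T) (c : R), measurable B -> H (fun x => c * \1_B x)) ->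
  (forall g h, measurable_fun [set: T] g -> measurable_fun [set: T] h ->
    H g -> H h -> H (g \+ h)) ->
  forall f : T -> R, measurable_fun [set: T] f ->
  exists g : (T -> R)^nat,
    [/\ forall n, measurable_fun [set: T] (g n), forall n, H (g n),
        forall n x, `|g n x| <= `|f x|
      & forall x, g n x @[n --> \oo] --> f x].
Proof.
move=> H0 HI HD f mf.
(* A simple function is a finite sum of multiples of indicators of its level sets. Measurability is
   carried through the induction because [HD] asks for it. *)
have Hnn (c : R) (h : {nnsfun T >-> R}) :
    measurable_fun [set: T] (fun x => c * h x) /\ H (fun x => c * h x).
  have -> : (fun x => c * h x) =
      (fun x => \sum_(y <- finmap.enum_fset (fset_set (range h)))
        c * y * \1_(h @^-1` [set y]) x).
    apply/funext => x; rewrite fimfunE fsbig_finite//= mulr_sumr.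
    by apply: eq_bigr => y _; rewrite mulrA.
  elim: (finmap.enum_fset _) => [|y s [mh IH]].
    have -> : (fun x => \sum_(y <- [::]) c * y * \1_(h @^-1` [set y]) x) =
        cst 0.
      by apply/funext => x; rewrite big_nil.
    by split; [exact: measurable_cst|].
  have mB : measurable (h @^-1` [set y]) by exact: measurable_funPTI.
  have -> : (fun x => \sum_(y <- y :: s) c * y * \1_(h @^-1` [set y]) x) =
     (fun x => c * y * \1_(h @^-1` [set y]) x) \+
     (fun x => \sum_(y <- s) c * y * \1_(h @^-1` [set y]) x).
    by apply/funext => x /=; rewrite big_cons.
  have mI : measurable_fun [set: T] (fun x => c * y * \1_(h @^-1` [set y]) x).
    by apply: measurable_funM => //; exact: measurable_indic.
  by split; [exact: measurable_funD|apply: HD => //; exact: HI].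
have mp : measurable_fun [set: T] (EFin \o f^\+).
  by apply/measurable_EFinP; exact: measurable_funrpos.
have mn : measurable_fun [set: T] (EFin \o f^\-).
  by apply/measurable_EFinP; exact: measurable_funrneg.
pose p := nnsfun_approx measurableT mp; pose q := nnsfun_approx measurableT mn.
have p0 x : [set: T] x -> (0 <= (EFin \o f^\+%R) x)%E.
  by move=> _; rewrite lee_fin funrpos_ge0.
have q0 x : [set: T] x -> (0 <= (EFin \o f^\-%R) x)%E.
  by move=> _; rewrite lee_fin funrneg_ge0.
have E n x : p n x - q n x = 1 * p n x + (-1) * q n x by rewrite mul1r mulN1r.
have fB x : f x = f^\+%R x - f^\-%R x by rewrite -[in LHS](funrposBneg f).
have fD x : `|f x| = f^\+%R x + f^\-%R x.
  by have /(congr1 (fun h => h x)) /= := funrposDneg f.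
exists (fun n x => p n x - q n x); split.
- by move=> n; apply: measurable_funB; exact: measurable_funPT.
- move=> n; under eq_fun do rewrite E.
  by apply: HD; have := Hnn 1 (p n); have := Hnn (-1) (q n) => -[? ?] [? ?].
- move=> n x; rewrite fD.
  have := le_approx n p0 (I : setT x); have := le_approx n q0 (I : setT x).
  rewrite -!nnsfun_approxE !lee_fin => qf pf.
  by rewrite (le_trans (ler_normB _ _))// !ger0_norm// lerD.
- move=> x; rewrite fB; apply: cvgB.
    by have /fine_cvg := cvg_nnsfun_approx measurableT mp p0 (I : setT x).
  by have /fine_cvg := cvg_nnsfun_approx measurableT mn q0 (I : setT x).
Qed.

End SimpleApproximation.

(** * The mid-distribution function *)

Lemma negligible_bigcup_count d (T : measurableType d) (R : realType)
    (mu : {measure set T -> \bar R}) (I : countType) (F : I -> set T) :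
  (forall i, mu.-negligible (F i)) -> mu.-negligible (\bigcup_i F i).
Proof.
move=> F0; pose G n := if unpickle n is Some i then F i else set0.
apply: (negligibleS _ (negligible_bigcup (F := G) _)) => [w [i _ Fiw]|n].
  by exists (pickle i) => //; rewrite /G pickleK.
by rewrite /G; case: unpickle => [i|]; [exact: F0|exact: negligible_set0].
Qed.

(** Linear factors are split off one at a time until no root is left; each lowers the size by
    one. *)
Lemma poly_roots_seq (F : idomainType) (p : {poly F}) : p != 0 ->
  exists2 s : seq F, forall x, root p x -> x \in s & (size s < size p)%N.
Proof.
move: {2}(size p) (leqnn (size p)) => n; elim: n p => [|n IH] p.
  by rewrite leqn0 size_poly_eq0 => ->.
move=> pn p0; have [[a pa]|nr] := pselect (exists a, root p a); last first.
  exists [::]; last by rewrite lt0n size_poly_eq0.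
  by move=> x px; case: nr; exists x.
have /factor_theorem [q pE] := pa.
have q0 : q != 0 by apply: contraNneq p0 => q0; rewrite pE q0 mul0r.
have sp : size p = (size q).+1.
  by rewrite pE size_Mmonic ?monicXsubC// size_XsubC addn2.
have [|s rs ss] := IH q _ q0; first by rewrite -ltnS -sp.
exists (a :: s); last by rewrite sp.
move=> x; rewrite pE rootM root_XsubC inE => /orP[/rs ->|->//].
by rewrite orbT.
Qed.

Lemma bounded_integrable d (T : measurableType d) (R : realType)
    (P : probability T R) (f : T -> R) (M : R) :
  measurable_fun [set: T] f -> (forall w, `|f w| <= M) ->
  P.-integrable [set: T] (EFin \o f).
Proof.
move=> mf fM; apply: measurable_bounded_integrable => //.
  by rewrite (le_lt_trans (probability_le1 P measurableT))// ltry.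
exists M; split; first exact: num_real.
by move=> x Mx w _; exact: le_trans (fM w) (ltW Mx).
Qed.

Section MidDistribution.
Context d (T : measurableType d) (R : realType) (P : probability T R)
  (X : {RV P >-> R}).

Let mpre (A : set R) : measurable A -> measurable (X @^-1` A).
Proof. by move=> mA; exact: measurable_funPTI. Qed.

Let prob_eq0 (A : set R) : measurable A -> fine (P (X @^-1` A)) <= 0 ->
  P (X @^-1` A) = 0%E.
Proof.
move=> mA; rewrite -lee_fin fineK; last first.
  by rewrite fin_num_measure//; exact: mpre.
by move=> A0; apply/eqP; rewrite eq_le measure_ge0 A0.
Qed.

Lemma cdf_itv x y : x <= y ->
  fine (cdf X y) = fine (cdf X x) + fine (P (X @^-1` `]x, y])).
Proof.
move=> xy; have -> : cdf X y = (cdf X x + P (X @^-1` `]x, y]))%E.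
  rewrite /cdf /distribution /pushforward -measureU; [|exact: mpre..|].
    rewrite -preimage_setU; congr (P (X @^-1` _)); apply/seteqP; split=> z /=.
      rewrite !in_itv/= => zy; rewrite zy andbT.
      by case: (leP z x); [left|right].
    by rewrite !in_itv/= => -[/le_trans|/andP[]//]; apply.
  apply/seteqP; split=> // w [] /=; rewrite !in_itv/= => wx /andP[+ _].
  by rewrite ltNge wx.
by rewrite fineD// fin_num_measure//; exact: mpre.
Qed.

(** The increment is the mass of []x, y]], minus half the atom at [y], plus half the atom at [x];
    the atom at [y] is part of that interval and costs at most half of its mass. *)
Lemma mid_cdfB_ge x y : x < y ->
  (fine (P (X @^-1` `]x, y])) + pmf X x) / 2 <= mid_cdf X y - mid_cdf X x.
Proof.
move=> xy; rewrite /mid_cdf (cdf_itv (ltW xy)).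
have : pmf X y <= fine (P (X @^-1` `]x, y])).
  rewrite /pmf fine_le ?fin_num_measure//; [exact: mpre..|].
  rewrite le_measure ?inE//; [exact: mpre..|].
  by move=> w /= ->; rewrite in_itv/= xy lexx.
by lra.
Qed.

Lemma mid_cdf_nondecreasing : {homo mid_cdf X : x y / x <= y}.
Proof.
move=> x y; rewrite le_eqVlt => /predU1P[->//|xy].
rewrite -subr_ge0; apply: le_trans (mid_cdfB_ge xy).
by rewrite divr_ge0// addr_ge0 ?pmf_ge0// fine_ge0.
Qed.

Lemma measurable_mid_cdf : measurable_fun [set: R] (mid_cdf X).
Proof. exact: nondecreasing_measurable mid_cdf_nondecreasing. Qed.

Lemma mid_cdf_itv x : 0 <= mid_cdf X x <= 1.
Proof.
have p0 := pmf_ge0 X x.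
have pF : pmf X x <= fine (cdf X x).
  rewrite /pmf fine_le ?fin_num_measure//; [exact: mpre..|].
  rewrite le_measure ?inE//; [exact: mpre..|].
  by move=> w /= ->; rewrite in_itv/= lexx.
have F1 : fine (cdf X x) <= 1.
  by rewrite -lee_fin fineK ?fin_num_measure//; exact: cdf_le1.
by rewrite /mid_cdf; apply/andP; split; lra.
Qed.

(* A null set off which [mid_cdf X] is injective. *)
Definition flat_points : set R :=
  [set y | exists2 q : rat, ratr q < y & P (X @^-1` `](ratr q : R), y]) = 0%E].

(** It suffices to fix the left endpoint [a], since there are countably many rationals. The points
    reached from [a] through a null interval are then covered by countably many null intervals. *)
Lemma negligible_flat_points : P.-negligible (X @^-1` flat_points).
Proof.
pose A (a : R) := [set y | a < y /\ P (X @^-1` `]a, y]) = 0%E].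
have null a b : P (X @^-1` `]a, b]) = 0%E ->
    P.-negligible (X @^-1` `]a, b]).
  by move=> ab0; exists (X @^-1` `]a, b]); split=> //; exact: mpre.
suff nA a : P.-negligible (X @^-1` (A a)).
  apply: (negligibleS _ (negligible_bigcup_count
    (F := fun q : rat => X @^-1` (A (ratr q))) _)) => [w [q qw q0]|//].
  by exists q.
(* With a largest such point [M], the single null interval []a, M]] covers them all. Otherwise a
   rational fits between each of them and a larger one, and the null intervals []a, q]] with [q]
   rational suffice. *)
have [[M [[aM M0] Mmax]]|nomax] :=
    pselect (exists M, A a M /\ forall z, A a z -> z <= M).
  apply: negligibleS (null _ _ M0) => w [aw w0] /=.
  by rewrite in_itv/= aw Mmax.
pose F (q : rat) : set T := [set w | P (X @^-1` `]a, ratr q]) = 0%E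
  /\ a < X w <= ratr q].
apply: (negligibleS _ (negligible_bigcup_count (F := F) _)) => [w [aw w0]|q].
  have [z [az z0] wz] : exists2 z, A a z & X w < z.
    apply: contrapT => nz; apply: nomax; exists (X w); split=> // z Az.
    by rewrite leNgt; apply/negP => wz; apply: nz; exists z.
  have [q] := rat_in_itvoo wz; rewrite in_itv/= => /andP[wq qz].
  exists q => //; split; last by rewrite aw ltW.
  apply/eqP; rewrite -measure_le0 -z0 le_measure ?inE//; [exact: mpre..|].
  by move=> v /=; rewrite !in_itv/= => /andP[-> /le_trans->//]; exact: ltW.
have [q0|q0] := pselect (P (X @^-1` `]a, ratr q]) = 0%E).
  by apply: negligibleS (null _ _ q0) => w [_] /=; rewrite in_itv.
by apply: negligibleS (negligible_set0 P) => w [].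
Qed.

(** A zero increment forces []x, y]] to be null, and hence also []q, y]] for any rational [q]
    between [x] and [y]. *)
Lemma flat_pointsP x y : x < y -> mid_cdf X x = mid_cdf X y -> flat_points y.
Proof.
move=> xy xyE; have := mid_cdfB_ge xy; rewrite xyE subrr => xy0.
have [q] := rat_in_itvoo xy; rewrite in_itv/= => /andP[xq qy].
exists q => //; apply: prob_eq0 => //.
apply: (@le_trans _ _ (fine (P (X @^-1` `]x, y])))).
  rewrite fine_le ?fin_num_measure//; [exact: mpre..|].
  rewrite le_measure ?inE//; [exact: mpre..|].
  by move=> v /=; rewrite !in_itv/= => /andP[/(lt_trans xq)-> ->].
by have := pmf_ge0 X x; lra.
Qed.

Lemma mid_cdf_inj x y : ~ flat_points x -> ~ flat_points y ->
  mid_cdf X x = mid_cdf X y -> x = y.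
Proof.
move=> fx fy xyE; have [xy|yx|//] := ltgtP x y.
  by case: fy; exact: flat_pointsP xyE.
by case: fx; exact: flat_pointsP (esym xyE).
Qed.

Lemma pmf_gt0_not_flat x : 0 < pmf X x -> ~ flat_points x.
Proof.
move=> px [q qx q0]; suff : pmf X x <= 0 by rewrite leNgt px.
have -> : (0 : R) = fine (P (X @^-1` `](ratr q : R), x])) by rewrite q0.
rewrite /pmf fine_le ?fin_num_measure//; [exact: mpre..|].
rewrite le_measure ?inE//; [exact: mpre..|].
by move=> w /= ->; rewrite in_itv/= qx lexx.
Qed.

(** Duplicates and points of zero mass are discarded; finitely many null points form a null set, so
    the remaining list still carries all the mass. *)
Lemma negligible_takes_values (s : seq R) :
  P.-negligible (X @^-1` (~` [set` s])) ->
  exists2 s', takes_values X s' & (size s' <= size s)%N.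
Proof.
move=> s0; exists [seq x <- undup s | 0 < pmf X x]; last first.
  by rewrite size_filter (leq_trans (count_size _ _))// size_undup.
split.
- by rewrite filter_uniq// undup_uniq.
- by move=> x; rewrite mem_filter => /andP[].
set s' := [seq x <- undup s | 0 < pmf X x].
have ms' : measurable (X @^-1` [set` s']).
  by apply: mpre; exact/countable_measurable/finite_set_countable/finite_seq.
have : P.-negligible (~` (X @^-1` [set` s'])).
  apply: (@negligibleS _ _ _ _ (X @^-1` (~` [set` s]) `|`
      \big[setU/set0]_(x <- s | pmf X x == 0) (X @^-1` [set x]))).
    move=> w /= Xw; have [Xs|] := boolP (X w \in s); last by move/negP; left.
    right; rewrite -bigcup_seq_cond; exists (X w) => //=.
    rewrite Xs/= eq_le pmf_ge0 andbT leNgt; apply/negP => X0; apply: Xw.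
    by rewrite mem_filter X0 mem_undup.
  apply: negligibleU => //; elim: s {s0 s' ms'} => [|x s IH].
    by rewrite big_nil; exact: negligible_set0.
  rewrite big_cons; case: ifPn => // /eqP x0; apply: negligibleU => //.
  exists (X @^-1` [set x]); split=> //.
  by apply: prob_eq0; rewrite // -/(pmf X x) x0.
move=> /negligibleP -/(_ (measurableC ms')) s'0.
by rewrite -[X @^-1` _]setCK probability_setC ?s'0 ?sube0//; exact: measurableC.
Qed.

(** Almost surely the mid-distribution value is one of the finitely many roots, and off the flat
    points each root has at most one preimage. *)
Lemma finite_support (p : {poly R}) : p != 0 ->
  P.-negligible [set w | ~~ root p (mid_cdf X (X w))] ->
  exists2 s, takes_values X s & (size s < size p)%N.
Proof.
move=> p0 np; have [rs rsP srs] := poly_roots_seq p0.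
(* The non-flat preimage of [c]. A root without one yields the default 0, which merely adds a
   harmless candidate to the list. *)
pose m c := xget 0 [set y | mid_cdf X y = c /\ ~ flat_points y].
have [|s sP ss] := @negligible_takes_values (map m rs).
  apply: negligibleS (negligibleU np negligible_flat_points) => w /= nw.
  have [fw|fw] := pselect (flat_points (X w)); first by right.
  left; apply/negP => /rsP wr; apply: nw.
  have [] : [set y | mid_cdf X y = mid_cdf X (X w) /\ ~ flat_points y]
      (m (mid_cdf X (X w))) by exact: xgetI.
  by move=> /[swap] fm /(mid_cdf_inj fm fw) <-; exact: map_f.
by exists s => //; rewrite (leq_ltn_trans ss)// size_map.
Qed.

Lemma expectation_sq_eq0 (f : T -> R) : measurable_fun [set: T] f ->
  'E_P[fun w => (f w ^+ 2)%R]%E = 0%E -> P.-negligible [set w | f w != 0].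
Proof.
move=> mf; rewrite unlock => f0.
have := (ae_eq_integral_abs P measurableT
  (_ : measurable_fun [set: T] (fun w => (f w ^+ 2)%:E))).1.
rewrite (eq_integral (fun w => (f w ^+ 2)%:E)); last first.
  by move=> w _; rewrite abse_EFin// ger0_norm// sqr_ge0.
move=> /(_ _ f0) [].
  by apply/measurable_EFinP; exact: measurable_funX.
move=> N [mN N0 fN]; exists N; split=> // w /= fw; apply: fN => /= /(_ I) [].
by apply/eqP; rewrite sqrf_eq0.
Qed.

(** With zero variance, [mid_cdf X] would almost surely equal its mean [c], a root of a polynomial
    of degree one. Then [X] would take at most one value: no value contradicts total mass 1, one
    value contradicts nondegeneracy. *)
Lemma mid_sd_gt0 : nondegenerate_law X -> 0 < mid_sd X.
Proof.
move=> nd; rewrite /mid_sd sqrtr_gt0 lt_neqAle fine_ge0 ?variance_ge0// andbT.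
apply/eqP => V0; set c := fine ('E_P[mid_cdf X \o X])%E.
have mG : measurable_fun [set: T] (mid_cdf X \o X).
  apply: measurableT_comp; last exact: measurable_funPT.
  exact: measurable_mid_cdf.
have bG w : `|mid_cdf X (X w)| <= 1.
  by have /andP[? ?] := mid_cdf_itv (X w); rewrite ger0_norm.
pose f w := mid_cdf X (X w) - c.
have mf : measurable_fun [set: T] f by apply: measurable_funB.
have fM w : `|f w ^+ 2| <= (1 + `|c|) ^+ 2.
  rewrite normrX lerXn2r ?nnegrE// ?addr_ge0//.
  by rewrite (le_trans (ler_normB _ _))// lerD2r.
have f0 : 'E_P[fun w => (f w ^+ 2)%R]%E = 0%E.
  have VE : 'V_P[mid_cdf X \o X]%E = 'E_P[fun w => (f w ^+ 2)%R]%E.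
    by rewrite /variance unlock; congr expectation; apply/funext => w.
  (* [V0] speaks of [fine], which also sends infinity to 0; boundedness of [f] makes the variance
     finite. *)
  rewrite -VE -[LHS]fineK -?V0// VE unlock.
  apply: integrable_fin_num => //; apply: bounded_integrable fM.
  exact: measurable_funX.
have [||s [us ps s1]] := @finite_support ('X - c%:P).
- by rewrite polyXsubC_eq0.
- apply: negligibleS (expectation_sq_eq0 mf f0) => w /=.
  by rewrite root_XsubC subr_eq0.
rewrite size_XsubC; case: s s1 {us ps} => [|x [|]]// s1 _.
  by move: s1; rewrite set_nil preimage_set0 measure0 => /eqP; rewrite lt_eqF.
by apply: (nd x); rewrite -s1 set_cons1.
Qed.

End MidDistribution.

(** * Conditional means *)

Lemma integrable_mul_bounded d (T : measurableType d) (R : realType)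
    (P : probability T R) (f h : T -> R) (M : R) :
  P.-integrable [set: T] (EFin \o f) -> measurable_fun [set: T] h ->
  (forall w, `|h w| <= M) ->
  P.-integrable [set: T] (EFin \o (fun w => f w * h w)).
Proof.
move=> fi mh hM; have : [bounded h x | x in [set: T]].
  exists M; split; first exact: num_real.
  by move=> x Mx w _; exact: le_trans (hM w) (ltW Mx).
move=> hb; have := integrableMl measurableT fi mh hb.
by apply: eq_integrable => // w _; rewrite /= EFinM.
Qed.

Section ConditionalMean.
Context d (T : measurableType d) (R : realType) (P : probability T R)
  (X Y : {RV P >-> R}).

(** The defining identity of [cond_mean] is the case of an indicator. Linearity gives simple
    functions, and dominated convergence with bound [M * |r(X) - Y|] gives bounded [g]. *)
Lemma cond_mean_mul_bounded (r g : R -> R) (M : R) :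
  P.-integrable [set: T] (fun w => (Y w)%:E) -> cond_mean X Y r ->
  measurable_fun [set: R] g -> (forall x, `|g x| <= M) ->
  \int[P]_w (r (X w) * g (X w)) = \int[P]_w (Y w * g (X w)).
Proof.
move=> iY [mr ir rY] mg gM; pose D w := r (X w) - Y w.
have mX : measurable_fun [set: T] X by exact: measurable_funPT.
have iD : P.-integrable [set: T] (EFin \o D) by exact: integrableB ir iY.
(* Boundedness is part of the property because splitting the integral of a sum needs both products
   with [D] integrable. *)
pose H (h : R -> R) := (exists M : R, forall x, `|h x| <= M) /\
  \int[P]_w (D w * h (X w)) = 0.
have iDh (h : R -> R) (N : R) : measurable_fun [set: R] h ->
    (forall x, `|h x| <= N) ->
    P.-integrable [set: T] (EFin \o (fun w => D w * h (X w))).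
  move=> mh hN; apply: (integrable_mul_bounded (M := N)) => //.
  exact: measurableT_comp.
have [|B c mB|h k mh mk [[Mh hM] h0] [[Mk kM] k0]|gn [mgn Hgn gng gn_g]] :=
    @dominated_simple_approx _ _ _ H _ _ _ g mg.
- split; first by exists 0 => x; rewrite normr0.
  by rewrite /Rintegral integral0_eq// => w _; rewrite mulr0.
- split.
    exists `|c| => x; rewrite normrM ler_piMr//.
    by rewrite indicE; case: (_ \in _); rewrite ?normr1 ?normr0.
  have mXB : measurable (X @^-1` B) by exact: measurable_funPTI.
  rewrite (_ : (fun w => D w * (c * \1_B (X w))) =
      (fun w => c * (D \_ (X @^-1` B)) w)); last first.
    apply/funext => w; rewrite mulrCA patchE indicE.
    rewrite (_ : (w \in X @^-1` B) = (X w \in B)).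
      by case: ifP; rewrite ?mulr1 ?mulr0.
    by apply/idP/idP; rewrite !inE.
  have iDB : P.-integrable (X @^-1` B) (EFin \o D) by exact: integrableS iD.
  rewrite RintegralZl//; last first.
    by move/integrable_mkcond : iDB => /(_ mXB); rewrite restrict_EFin.
  rewrite -Rintegral_mkcond /D RintegralB//; last 2 first.
  + exact: integrableS ir.
  + exact: integrableS iY.
  by rewrite /Rintegral rY// subrr mulr0.
- split.
    by exists (Mh + Mk) => x; rewrite (le_trans (ler_normD _ _))// lerD.
  rewrite (_ : (fun w => _) = (fun w => D w * h (X w) + D w * k (X w))).
    by rewrite RintegralD ?h0 ?k0 ?addr0//; [exact: iDh hM|exact: iDh kM].
  by apply/funext => w; rewrite /= mulrDr.
have Dg0 : \int[P]_w (D w * g (X w)) = 0.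
  have [|||||_ _] := @dominated_convergence _ _ _ P _ measurableT
    (fun n w => (D w * gn n (X w))%:E) (fun w => (D w * g (X w))%:E)
    (fun w => (M * `|D w|)%:E).
  - move=> n; have [[N hN] _] := Hgn n.
    by have /integrableP[] := iDh _ _ (mgn n) hN.
  - by have /integrableP[] := iDh _ _ mg gM.
  - apply: aeW => w _; apply: cvg_EFin; first exact: nearW.
    by apply: cvgMr; exact: gn_g.
  - have := integrableZl measurableT M (integrable_abse iD).
    by apply: eq_integrable => // w _; rewrite /= EFinM.
  - apply: aeW => w n _; rewrite lee_fin normrM mulrC ler_wpM2r//.
    exact: le_trans (gng _ _) (gM _).
  rewrite -[X in _ --> X -> _]fineK; last first.
    by apply: integrable_fin_num => //; exact: iDh mg gM.
  move=> /fine_cvg /= cv; apply: (cvg_unique (@Rhausdorff R) cv).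
  by apply: cvg_near_cst; apply: nearW => n; have [] := Hgn n.
have ir' : P.-integrable [set: T] (EFin \o (fun w => r (X w) * g (X w))).
  by apply: (integrable_mul_bounded (M := M)) => //; exact: measurableT_comp.
have iY' : P.-integrable [set: T] (EFin \o (fun w => Y w * g (X w))).
  by apply: (integrable_mul_bounded (M := M)) => //; exact: measurableT_comp.
apply/eqP; rewrite -subr_eq0 -RintegralB//; apply/eqP; rewrite -Dg0.
by congr Rintegral; apply/funext => w; rewrite /D mulrBl.
Qed.

End ConditionalMean.

(** * Density of polynomials *)

Section SignIteration.
Context (R : realType).

Let step (u : R) := (3 * u - u ^+ 3) / 2.

(** The map is odd and fixes -1, 0 and 1, so the positive case suffices. There [1 - step t = (1 - t)
    * (1 - (t + t ^+ 2) / 2)], and the iterates never fall below the starting value [v], so the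
    distance to 1 shrinks by a factor of at most [1 - v / 2]. *)
Lemma iter_sign_step_cvg (u : R) : -1 <= u <= 1 ->
  (forall n, -1 <= iter n (fun u => (3 * u - u ^+ 3) / 2) u <= 1) /\
  iter n (fun u => (3 * u - u ^+ 3) / 2) u @[n --> \oo] --> Num.sg u.
Proof.
rewrite -/step => u1.
have step_pos v : 0 < v <= 1 -> (forall n, v <= iter n step v <= 1) /\
    iter n step v @[n --> \oo] --> (1 : R).
  move=> /andP[v0 v1].
  have vn n : v <= iter n step v <= 1 /\ 1 - iter n step v <= (1 - v / 2) ^+ n.
    elim: n => [|n [/andP[a b] c]] /=; first by rewrite expr0; split; lra.
    set t := iter n step v in a b c *.
    have E : 1 - step t = (1 - t) * (1 - (t + t ^+ 2) / 2).
      by rewrite /step; field.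
    split.
      apply/andP; split; last by rewrite -subr_ge0 E mulr_ge0//; nra.
      rewrite -subr_ge0 (_ : step t - v = (t - v) + t * (1 - t ^+ 2) / 2).
        by rewrite addr_ge0//; nra.
      by rewrite /step; field.
    rewrite E [leRHS]exprSr ler_pM//; [lra|nra|nra].
  split=> [n|]; first by have [] := vn n.
  apply: (@squeeze_cvgr _ _ _ _ (fun n => 1 - (1 - v / 2) ^+ n) (cst 1)).
  - apply: nearW => n; have [/andP[_ b] c] := vn n; rewrite b andbT; lra.
  - rewrite -[X in _ --> X]subr0; apply: cvgB; first exact: cvg_cst.
    by apply: cvg_expr; rewrite ger0_norm; lra.
  - exact: cvg_cst.
have [u0|u0|<-] := ltgtP 0 u; last first.
- have E n : iter n step 0 = 0 by elim: n => //= n ->; rewrite /step; field.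
  split=> [n|]; first by rewrite E; lra.
  by rewrite sgr0; apply: cvg_near_cst; apply: nearW => n; exact: E.
- have E n : iter n step u = - iter n step (- u).
    elim: n => [|n IH] /=; first by rewrite opprK.
    by rewrite IH /step; field.
  have [|B C] := step_pos (- u); first by lra.
  split=> [n|]; first by rewrite E; have := B n; lra.
  rewrite ltr0_sg//; under eq_fun do rewrite E.
  exact: cvgN.
- have [|B C] := step_pos u; first by lra.
  split=> [n|]; first by have := B n; lra.
  by rewrite gtr0_sg.
Qed.

End SignIteration.

Lemma measurable_horner d (T : measurableType d) (R : realType)
    (f : T -> R) (p : {poly R}) :
  measurable_fun [set: T] f -> measurable_fun [set: T] (fun x => p.[f x]).
Proof.
move=> mf; under eq_fun do rewrite horner_coef.
apply: measurable_sum => i; apply: measurable_funM => //.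
exact: measurable_funX.
Qed.

(** * Mean-square approximation by polynomials in a fixed function *)

Section PolynomialApproximation.
Context d (T : measurableType d) (R : realType) (P : probability T R)
  (X : {RV P >-> R}).

Let mX : measurable_fun [set: T] X. Proof. exact: measurable_funPT. Qed.

(** Extended-real valued, so that distances can be compared before any square-integrability is
    known. *)
Definition sq_dist (f g : R -> R) : \bar R :=
  (\int[P]_w ((f (X w) - g (X w)) ^+ 2)%:E)%E.

Let msq (f g : R -> R) : measurable_fun [set: R] f ->
  measurable_fun [set: R] g ->
  measurable_fun [set: T] (fun w => ((f (X w) - g (X w)) ^+ 2)%:E).
Proof.
move=> mf mg; apply/measurable_EFinP; apply: measurable_funX.
by apply: measurable_funB; exact: measurableT_comp.
Qed.

(** From [(a + b) ^+ 2 <= 2 * a ^+ 2 + 2 * b ^+ 2], whose two sides differ by [(a - b) ^+ 2]. It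
    replaces the triangle inequality without square roots. *)
Lemma sq_dist_split (f g f' g' f'' g'' : R -> R) :
  measurable_fun [set: R] f -> measurable_fun [set: R] g ->
  measurable_fun [set: R] f' -> measurable_fun [set: R] g' ->
  measurable_fun [set: R] f'' -> measurable_fun [set: R] g'' ->
  (forall x, f x - g x = (f' x - g' x) + (f'' x - g'' x)) ->
  (sq_dist f g <= 2%:E * sq_dist f' g' + 2%:E * sq_dist f'' g'')%E.
Proof.
move=> mf mg mf' mg' mf'' mg'' E.
rewrite /sq_dist -!ge0_integralZl//; try exact: msq;
  try by move=> w _; rewrite lee_fin sqr_ge0.
have mk (h k : R -> R) : measurable_fun [set: R] h ->
    measurable_fun [set: R] k ->
    measurable_fun [set: T] (fun w => 2%:E * ((h (X w) - k (X w)) ^+ 2)%:E)%E.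
  by move=> mh mk; apply: measurable_funeM; exact: msq.
have k0 (h k : R -> R) w : (0 <= 2%:E * ((h (X w) - k (X w)) ^+ 2)%:E)%E.
  by rewrite mule_ge0// lee_fin ?sqr_ge0.
rewrite -ge0_integralD//; try exact: mk.
apply: ge0_le_integral => //.
- by move=> w _; rewrite lee_fin sqr_ge0.
- exact: msq.
- by apply: emeasurable_funD; exact: mk.
- move=> w _; rewrite -!EFinM -EFinD lee_fin E.
  set a := f' _ - _; set b := f'' _ - _.
  by rewrite -subr_ge0 [leRHS](_ : _ = (a - b) ^+ 2) ?sqr_ge0//; ring.
Qed.

Definition poly_approximable (phi f : R -> R) : Prop :=
  forall e : R, 0 < e -> exists p : {poly R},
    (sq_dist f (fun x => p.[phi x]) <= e%:E)%E.

Section Closure.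
Context (phi : R -> R) (mphi : measurable_fun [set: R] phi).

Let mp (p : {poly R}) : measurable_fun [set: R] (fun x => p.[phi x]).
Proof. exact: measurable_horner. Qed.

(** The tolerance [e / 4] absorbs the factor 2 of [sq_dist_split] and the two summands. *)
Let half_half (e : R) (a b : \bar R) : (a <= (e / 4)%:E)%E ->
  (b <= (e / 4)%:E)%E -> (2%:E * a + 2%:E * b <= e%:E)%E.
Proof.
move=> ae be; have -> : e%:E = (2%:E * (e / 4)%:E + 2%:E * (e / 4)%:E)%E.
  by rewrite -!EFinM -EFinD; congr EFin; field.
by apply: leeD; rewrite lee_pmul2l.
Qed.

Lemma poly_approximable_poly (p : {poly R}) :
  poly_approximable phi (fun x => p.[phi x]).
Proof.
move=> e e0; exists p; rewrite /sq_dist integral0_eq ?lee_fin ?ltW// => w _.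
by rewrite subrr expr0n.
Qed.

Lemma poly_approximable_closed f : measurable_fun [set: R] f ->
  (forall e : R, 0 < e -> exists g : R -> R, [/\ measurable_fun [set: R] g,
    poly_approximable phi g & (sq_dist f g <= e%:E)%E]) ->
  poly_approximable phi f.
Proof.
move=> mf fg e e0; have e40 : 0 < e / 4 by lra.
have [g [mg ag fge]] := fg _ e40; have [p gpe] := ag _ e40.
exists p; apply: le_trans (half_half fge gpe).
by apply: sq_dist_split => // x; ring.
Qed.

Lemma poly_approximableD f g : measurable_fun [set: R] f ->
  measurable_fun [set: R] g ->
  poly_approximable phi f -> poly_approximable phi g ->
  poly_approximable phi (f \+ g).
Proof.
move=> mf mg af ag e e0; have e40 : 0 < e / 4 by lra.
have [p fp] := af _ e40; have [q gq] := ag _ e40.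
exists (p + q); apply: le_trans (half_half fp gq).
apply: sq_dist_split => //; first exact: measurable_funD.
by move=> x /=; rewrite hornerD; ring.
Qed.

Lemma poly_approximableZ c f : measurable_fun [set: R] f ->
  poly_approximable phi f -> poly_approximable phi (fun x => c * f x).
Proof.
(* Adding 1 keeps the divisor of [e] positive when [c] is 0. *)
move=> mf af e e0; have c0 : 0 < c ^+ 2 + 1 by rewrite ltr_wpDl ?sqr_ge0.
have [p fp] := af _ (divr_gt0 e0 c0); exists (c *: p).
rewrite /sq_dist.
under eq_integral do rewrite hornerZ -mulrBr exprMn EFinM.
rewrite ge0_integralZl ?lee_fin ?sqr_ge0//; last 2 first.
- exact: (msq mf (mp p)).
- by move=> w _; rewrite lee_fin sqr_ge0.
apply: (@le_trans _ _ ((c ^+ 2)%:E * (e / (c ^+ 2 + 1))%:E)%E).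
  by rewrite lee_wpmul2l// lee_fin sqr_ge0.
rewrite -EFinM lee_fin mulrA ler_pdivrMr// mulrC ler_pM2l//.
by rewrite lerDl.
Qed.

(** Dominated convergence applied to the squared errors, which tend to 0 pointwise under the bound
    [k]; one index with a small finite integral is enough. *)
Lemma poly_approximable_dominated (g : (R -> R)^nat) (f k : R -> R) :
  (forall n, measurable_fun [set: R] (g n)) -> measurable_fun [set: R] f ->
  (forall n, poly_approximable phi (g n)) ->
  (forall x, g n x @[n --> \oo] --> f x) ->
  (forall n x, (f x - g n x) ^+ 2 <= k x) ->
  P.-integrable [set: T] (fun w => (k (X w))%:E) ->
  poly_approximable phi f.
Proof.
move=> mg mf ag gf fgk ik; apply: poly_approximable_closed => // e e0.
have [||||| _ _] := @dominated_convergence _ _ _ P _ measurableT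
  (fun n w => ((f (X w) - g n (X w)) ^+ 2)%:E) (cst 0%E)
  (fun w => (k (X w))%:E).
- by move=> n; exact: msq.
- exact: measurable_cst.
- apply: aeW => w _; apply: cvg_EFin; first exact: nearW.
  rewrite [X in _ --> X](_ : _ = (f (X w) - f (X w)) * (f (X w) - f (X w))).
    by apply: cvgM; apply: cvgB; [exact: cvg_cst|exact: gf|exact: cvg_cst|exact: gf].
  by rewrite subrr mul0r.
- exact: ik.
- apply: aeW => w n _; rewrite lee_fin ger0_norm ?sqr_ge0//; exact: fgk.
rewrite integral_cst// mul0e => /fine_cvgP[fin /cvgr0_norm_le/(_ _ e0) le].
have [n [fn len]] := filter_ex (filterI fin le).
exists (g n); split=> //; rewrite /sq_dist -[leLHS]fineK// lee_fin.
by rewrite (le_trans (ler_norm _)).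
Qed.

Lemma poly_approximable_ae f g : measurable_fun [set: R] f ->
  measurable_fun [set: R] g ->
  P.-negligible [set w | f (X w) != g (X w)] ->
  poly_approximable phi g -> poly_approximable phi f.
Proof.
move=> mf mg fg ag; apply: poly_approximable_closed => // e e0.
exists g; split=> //; rewrite /sq_dist (ae_eq_integral (cst 0%E))//.
- by rewrite integral_cst// mul0e lee_fin ltW.
- exact: msq.
- apply: negligibleS fg => w /= nfg; apply/eqP => fg0.
  by apply: nfg => _; rewrite fg0 subrr expr0n.
Qed.

(** A pi-lambda argument: the rays are closed under intersection and generate the Borel sets, while
    approximability passes to proper differences by linearity and to increasing unions by dominated
    convergence. *)
Lemma poly_approximable_indic :
  (forall x, poly_approximable phi (\1_(`]x, +oo[%classic))) ->
  forall B, measurable B -> poly_approximable phi \1_B.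
Proof.
move=> ray; pose H : set (set R) :=
  [set B | measurable B /\ poly_approximable phi \1_B].
pose G := @RGenOInfty.G R.
have mG B : G B -> measurable B by move=> [x ->].
have mI (B : set R) : measurable B ->
  measurable_fun [set: R] (\1_B : R -> R) by move=> ?; exact: measurable_indic.
suff : G.-sigma.-measurable `<=` H.
  by move=> GH B mB; apply: (GH B _).2; rewrite -RGenOInfty.measurableE.
apply: lambda_system_subset => //.
- move=> _ _ [x ->] [y ->]; exists (Num.max x y); apply/seteqP.
  by split=> z /=; rewrite !in_itv/= !andbT gt_max => /andP.
- split=> //.
  + split=> //; apply: poly_approximable_ae (poly_approximable_poly 1%:P) => //.
    apply: negligibleS (negligible_set0 P) => w /=.
    by rewrite indicT hornerC eqxx.
  + move=> A B BA [mA aA] [mB aB]; split; first exact: measurableD.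
    rewrite (_ : \1_(A `\` B) = \1_A \+ (fun x => (-1) * \1_B x)).
      apply: poly_approximableD => //; last by apply: poly_approximableZ.
      by apply: measurable_funM => //; exact: mI.
    apply/funext => x /=; rewrite !indicE in_setD.
    case: (boolP (x \in B)) => xB; last by rewrite andbT mulr0 addr0.
    by rewrite andbF mem_set ?mulr1 ?subrr//; apply: BA; exact: set_mem.
  + move=> F ndF HF.
    have mF : measurable (\bigcup_i F i : set R).
      apply: bigcupT_measurable => i; exact: (HF i).1.
    split=> //; apply: (@poly_approximable_dominated (fun n => \1_(F n)) _ (cst 1)).
    * by move=> n; apply: mI; exact: (HF n).1.
    * exact: mI.
    * by move=> n; exact: (HF n).2.
    * move=> x; have [[i _ Fix]|nx] := pselect ((\bigcup_i F i) x).
        apply: cvg_near_cst; near=> n; rewrite !indicE !mem_set//.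
          by exists i.
        have /subsetPset : (F i <= F n)%O by apply: ndF; near: n; exists i.
        exact.
      apply: cvg_near_cst; apply: nearW => n; rewrite !indicE !memNset// => Fx.
      by apply: nx; exists n.
    * move=> n x; rewrite !indicE.
      by do 2 case: (_ \in _); rewrite ?subrr ?subr0 ?sub0r ?sqrrN ?expr1n ?expr0n.
    * by apply: (@bounded_integrable _ _ _ P (cst 1) 1) => // w; rewrite normr1.
- by move=> _ [x ->]; split.
Unshelve. all: by end_near. Qed.

(** Simple functions with [|gn n| <= |f|] converge to [f] pointwise, and their squared errors are
    dominated by [4 * f ^+ 2]. *)
Lemma poly_approximable_L2 :
  (forall x, poly_approximable phi (\1_(`]x, +oo[%classic))) ->
  forall f : R -> R, measurable_fun [set: R] f ->
  P.-integrable [set: T] (fun w => (f (X w) ^+ 2)%:E) ->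
  poly_approximable phi f.
Proof.
move=> ray f mf if2.
have [|B c mB|g h mg mh ag ah|gn [mgn agn gnf gn_f]] :=
    @dominated_simple_approx _ _ _ (poly_approximable phi) _ _ _ f mf.
- apply: poly_approximable_ae (poly_approximable_poly 0%:P) => //.
  by apply: negligibleS (negligible_set0 P) => w /=; rewrite horner0 eqxx.
- apply: poly_approximableZ; first exact: measurable_indic.
  exact: poly_approximable_indic.
- exact: poly_approximableD.
apply: (@poly_approximable_dominated gn f (fun x => 4 * f x ^+ 2)) => //.
- move=> n x; have := gnf n x; rewrite -(ler_pXn2r (n := 2)) ?nnegrE//.
  rewrite !real_normK ?num_real// => ?.
  (* Here [(f - g) ^+ 2 = 2 * f ^+ 2 + 2 * g ^+ 2 - (f + g) ^+ 2], and the square of [g] is at most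
     that of [f]. *)
  rewrite -subr_ge0; have := sqr_ge0 (f x + gn n x); nra.
- have := integrableZl measurableT 4 if2.
  by apply: eq_integrable => // w _; rewrite EFinM.
Qed.

End Closure.

End PolynomialApproximation.

(** * Polynomials in the first score function *)

Lemma normr_horner_le (R : realDomainType) (p : {poly R}) (M x : R) :
  `|x| <= M -> `|p.[x]| <= \sum_(i < size p) `|p`_i| * M ^+ i.
Proof.
move=> xM; rewrite horner_coef (le_trans (ler_norm_sum _ _ _))//.
apply: ler_sum => i _; rewrite normrM ler_wpM2l// normrX lerXn2r ?nnegrE//.
exact: le_trans xM.
Qed.

Section ScoreFunctional.
Context d (T : measurableType d) (R : realType) (P : probability T R)
  (X : {RV P >-> R}).

Lemma measurable_lp_score1 : measurable_fun [set: R] (lp_score1 X).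
Proof.
apply: measurable_funM => //; apply: measurable_funB => //.
exact: measurable_mid_cdf.
Qed.

Lemma lp_score1_bounded x : `|lp_score1 X x| <= 2^-1 / mid_sd X.
Proof.
rewrite /lp_score1 normrM ler_pM//; last by rewrite normfV ger0_norm ?sqrtr_ge0.
by have /andP[? ?] := mid_cdf_itv X x; rewrite ler_norml; lra.
Qed.

Lemma measurable_horner_score1 (p : {poly R}) :
  measurable_fun [set: T] (fun w => p.[lp_score1 X (X w)]).
Proof.
apply: measurable_horner; apply: measurableT_comp; last exact: measurable_funPT.
exact: measurable_lp_score1.
Qed.

Lemma horner_score1_bounded (p : {poly R}) :
  exists M, forall x, `|p.[lp_score1 X x]| <= M.
Proof. by eexists => x; apply: normr_horner_le; exact: lp_score1_bounded. Qed.

Lemma integrable_horner_score1 (p : {poly R}) :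
  P.-integrable [set: T] (EFin \o (fun w => p.[lp_score1 X (X w)])).
Proof.
have [M pM] := horner_score1_bounded p.
apply: (@bounded_integrable _ _ _ P _ M); first exact: measurable_horner_score1.
by move=> w; exact: pM.
Qed.

(** A linear functional on polynomials: inner products of polynomials in the first score function
    become its values at products, so Gram-Schmidt can be studied inside [{poly R}]. *)
Definition score_mean (p : {poly R}) : R :=
  \int[P]_w p.[lp_score1 X (X w)].

Lemma score_meanD p q : score_mean (p + q) = score_mean p + score_mean q.
Proof.
rewrite -RintegralD//; [|exact: integrable_horner_score1..].
by apply: eq_Rintegral => w _; rewrite hornerD.
Qed.

Lemma score_meanZ c p : score_mean (c *: p) = c * score_mean p.
Proof.
rewrite -RintegralZl//; [|exact: integrable_horner_score1..].
by apply: eq_Rintegral => w _; rewrite hornerZ.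
Qed.

Lemma score_mean_sum (I : Type) (s : seq I) (F : I -> {poly R}) :
  score_mean (\sum_(i <- s) F i) = \sum_(i <- s) score_mean (F i).
Proof.
elim/big_rec2 : _ => [|i _ y _ <-]; last by rewrite score_meanD.
by rewrite -(scale0r 0) score_meanZ mul0r.
Qed.

Lemma score_mean1 : score_mean 1 = 1.
Proof.
have := @Rintegral_cst _ _ _ P setT measurableT 1.
rewrite mul1r (_ : fine (P setT) = 1) => [<-|].
  by apply: eq_Rintegral => w _; rewrite hornerC.
by have /(congr1 fine) := probability_setT P.
Qed.

Lemma score_mean_sq_ge0 p : 0 <= score_mean (p * p).
Proof. by apply: Rintegral_ge0 => w _; rewrite hornerM -expr2 sqr_ge0. Qed.

Lemma law_dot_horner (p q : {poly R}) :
  law_dot X (fun x => p.[lp_score1 X x]) (fun x => q.[lp_score1 X x]) =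
  score_mean (p * q).
Proof.
rewrite /law_dot unlock; apply: eq_Rintegral => w _.
by rewrite hornerM.
Qed.

Section Nondegenerate.
Context (ndX : nondegenerate_law X).

(** The first score function is an affine image of the mid-distribution function. Composing [p] with
    that affine map [l] preserves the size and reduces the claim to [finite_support]. *)
Lemma score_mean_sq_eq0 (p : {poly R}) : p != 0 -> score_mean (p * p) = 0 ->
  exists2 s, takes_values X s & (size s < size p)%N.
Proof.
move=> p0 pp0; have sd0 := mid_sd_gt0 ndX.
pose l : {poly R} := (mid_sd X)^-1 *: ('X - (2^-1)%:P).
have lE x : l.[mid_cdf X x] = lp_score1 X x.
  by rewrite hornerZ hornerXsubC mulrC.
have sl : size l = 2%N.
  by rewrite size_scale ?size_XsubC// invr_eq0 gt_eqF.
have spl : size (p \Po l) = size p by rewrite size_comp_poly2.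
have [||s ? ?] := @finite_support _ _ _ P X (p \Po l).
- by rewrite -size_poly_eq0 spl size_poly_eq0.
- apply: negligibleS (expectation_sq_eq0 (measurable_horner_score1 p) _).
    by move=> w /=; rewrite /root horner_comp lE.
  rewrite unlock -[LHS]fineK.
    congr EFin; rewrite -[RHS]pp0; apply: eq_Rintegral => w _.
    by rewrite hornerM.
  apply: integrable_fin_num => //.
  apply: eq_integrable (integrable_horner_score1 (p * p)) => // w _.
  by rewrite /= hornerM.
by exists s; rewrite // -spl.
Qed.

(** A zero norm would leave [X] with at most [j] values, so [j] would not be an existing index. *)
Lemma score_mean_sq_gt0 (j : nat) (p : {poly R}) : lp_index X j -> p != 0 ->
  (size p <= j.+1)%N -> 0 < score_mean (p * p).
Proof.
move=> ij p0 sp; rewrite lt_neqAle score_mean_sq_ge0 andbT.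
apply/eqP => /esym /(score_mean_sq_eq0 p0) [s /ij js].
by move=> /leq_trans -/(_ _ sp); rewrite ltnS leqNgt js.
Qed.

(** Polynomial iteration turns the difference [mid_cdf X y - mid_cdf X x] into its sign in the
    limit, and the sign determines the indicator up to flat points. *)
Lemma ray_approximable x :
  poly_approximable X (lp_score1 X) (\1_(`]x, +oo[%classic) : R -> R).
Proof.
have sd0 := mid_sd_gt0 ndX; pose phi := lp_score1 X.
have mphi : measurable_fun [set: R] phi by exact: measurable_lp_score1.
(* Undoes the standardization; its values lie in the interval where the sign iteration converges. *)
pose q0 : {poly R} := mid_sd X *: ('X - (phi x)%:P).
have q0E y : q0.[phi y] = mid_cdf X y - mid_cdf X x.
  rewrite hornerZ hornerXsubC /phi /lp_score1; field.
  by rewrite gt_eqF.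
have q01 y : -1 <= q0.[phi y] <= 1.
  have := mid_cdf_itv X y; have := mid_cdf_itv X x; rewrite q0E.
  by move=> /andP[? ?] /andP[? ?]; apply/andP; split; lra.
pose q n := iter n (fun p : {poly R} => 2^-1 *: (3 *: p - p ^+ 3)) q0.
have qE n y : (q n).[phi y] =
    iter n (fun u => (3 * u - u ^+ 3) / 2) (q0.[phi y]).
  elim: n => //= n IH; rewrite hornerZ hornerD hornerN hornerZ horner_exp IH.
  by rewrite mulrC.
(* The map sending [u] to [(u + u ^+ 2) / 2] takes the signs -1 and 0 to 0 and the sign 1 to 1. *)
pose p n := 2^-1 *: (q n + q n ^+ 2).
have pE n y : (p n).[phi y] = 2^-1 * ((q n).[phi y] + (q n).[phi y] ^+ 2).
  by rewrite hornerZ hornerD horner_exp.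
pose A := mid_cdf X @^-1` `]mid_cdf X x, +oo[%classic.
have mA : measurable A.
  by rewrite -[A]setTI; exact: measurable_mid_cdf.
apply: (@poly_approximable_ae _ _ _ P X phi mphi _ (\1_A)) => //.
(* The two indicators differ only at points beyond [x] with the same mid-distribution value as [x],
   and these are flat. *)
- apply: negligibleS (negligible_flat_points X) => w /= /eqP.
  rewrite !indicE; apply: contra_notP => nf; congr (nat_of_bool _)%:R.
  apply/idP/idP; rewrite !inE /A /= !in_itv/= !andbT.
    move=> xw; rewrite lt_neqAle mid_cdf_nondecreasing ?ltW// andbT.
    by apply/eqP => /(flat_pointsP xw).
  by rewrite !ltNge; apply: contra; exact: mid_cdf_nondecreasing.
apply: (@poly_approximable_dominated _ _ _ P X phi mphi
    (fun n y => (p n).[phi y]) _ (cst 4)) => //.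
- by move=> n; exact: measurable_horner.
- by move=> n; exact: poly_approximable_poly.
- move=> y; have [_] := iter_sign_step_cvg (q01 y).
  under eq_fun do rewrite -qE.
  move=> cq; rewrite (_ : \1_A y =
    2^-1 * (Num.sg (q0.[phi y]) + Num.sg (q0.[phi y]) * Num.sg (q0.[phi y]))).
    under eq_fun do rewrite pE expr2.
    by apply: cvgMr; apply: cvgD => //; exact: cvgM.
  rewrite q0E indicE; case: sgrP => yx.
  + rewrite memNset /=; first by ring.
    by rewrite /A /= in_itv/= andbT; apply/negP; rewrite -leNgt; lra.
  + rewrite mem_set /=; first by field.
    by rewrite /A /= in_itv/= andbT; lra.
  + rewrite memNset /=; first by ring.
    by rewrite /A /= in_itv/= andbT; apply/negP; rewrite -leNgt; lra.
(* Both the indicator and its approximation lie between -1 and 1, whence the bound 4 on the squared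
   error. *)
- move=> n y; have := (iter_sign_step_cvg (q01 y)).1 n; rewrite -qE pE.
  set u := (q n).[_] => /andP[u1 u2].
  have : 0 <= (\1_A y : R) <= 1 by rewrite indicE ler0n lern1 leq_b1.
  set a := \1_A y; move=> /andP[a0 a1] /=.
  have [v1 v2] : -1 <= 2^-1 * (u + u ^+ 2) /\ 2^-1 * (u + u ^+ 2) <= 1.
    by split; nra.
  by set v := 2^-1 * _ in v1 v2 *; nra.
- by apply: (@bounded_integrable _ _ _ P (cst 4) 4) => // w; rewrite ger0_norm.
Qed.

End Nondegenerate.

End ScoreFunctional.

(** * Gram-Schmidt *)

Section ScorePolynomials.
Context d (T : measurableType d) (R : realType) (P : probability T R)
  (X : {RV P >-> R}).
Let L : {poly R} -> R := score_mean X.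

Let LZ c p : L (c *: p) = c * L p. Proof. exact: score_meanZ. Qed.
Let LD p q : L (p + q) = L p + L q. Proof. exact: score_meanD. Qed.
Let LN p : L (- p) = - L p.
Proof. by rewrite -scaleN1r LZ mulN1r. Qed.
Let Lsum (I : Type) (s : seq I) (F : I -> {poly R}) :
  L (\sum_(i <- s) F i) = \sum_(i <- s) L (F i).
Proof. exact: score_mean_sum. Qed.

(* The score functions are polynomials in [lp_score1 X]: Gram-Schmidt is run on
   the polynomials ['X^m] for the bilinear form [score_mean X (p * q)]. *)
Fixpoint score_polys (n : nat) : seq {poly R} :=
  if n is m.+1 then
    let r := 'X^m - \sum_(q <- score_polys m) L ('X^m * q) *: q in
    rcons (score_polys m) ((Num.sqrt (L (r * r)))^-1 *: r)
  else [::].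

Definition score_poly (j : nat) : {poly R} := (score_polys j.+1)`_j.

Definition score_residual (j : nat) : {poly R} :=
  'X^j - \sum_(i < j) L ('X^j * score_poly i) *: score_poly i.

Lemma size_score_polys n : size (score_polys n) = n.
Proof. by elim: n => //= n IH; rewrite size_rcons IH. Qed.

(** The lists only grow at the end, so an entry no longer changes once computed. *)
Lemma nth_score_polys n i : (i < n)%N -> (score_polys n)`_i = score_poly i.
Proof.
elim: n => // n IH; rewrite ltnS leq_eqVlt => /predU1P[->//|lin] /=.
by rewrite nth_rcons size_score_polys lin IH.
Qed.

Lemma score_polyE j : score_poly j =
  (Num.sqrt (L (score_residual j * score_residual j)))^-1 *: score_residual j.
Proof.
have -> : score_residual j =
    'X^j - \sum_(q <- score_polys j) L ('X^j * q) *: q.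
  rewrite (big_nth 0) size_score_polys big_mkord; congr (_ - _).
  by apply: eq_bigr => i _; rewrite nth_score_polys.
by rewrite {1}/score_poly /= nth_rcons size_score_polys ltnn eqxx.
Qed.

Lemma lp_scoresE n : lp_scores X n =
  [seq (fun x => p.[lp_score1 X x]) | p <- score_polys n].
Proof.
elim: n => //= n IH; rewrite map_rcons IH; congr rcons.
set r := 'X^n - _.
have rE : gs_residual X [seq (fun x => p.[lp_score1 X x]) | p <- score_polys n]
    (fun x => lp_score1 X x ^+ n) = (fun x => r.[lp_score1 X x]).
  apply/funext => x; rewrite /gs_residual big_map hornerD hornerN hornerXn.
  rewrite horner_sum; congr (_ - _); apply: eq_bigr => q _.
  rewrite hornerZ /L -law_dot_horner; congr (law_dot X _ _ * _).
  by apply/funext => y; rewrite hornerXn.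
apply/funext => x; rewrite rE /gs_normalize law_dot_horner hornerZ.
by rewrite mulrC.
Qed.

Lemma lp_scoreE j x : lp_score X j x = (score_poly j).[lp_score1 X x].
Proof.
rewrite /lp_score lp_scoresE (nth_map 0) ?size_score_polys//.
Qed.

(** The residual is ['X^j] minus terms of lower degree. For the normalized polynomial only an upper
    bound holds: beyond the existing indices the norm may be 0, and scaling by its inverse then
    gives 0. *)
Lemma size_score_poly_residual j :
  size (score_residual j) = j.+1 /\ (size (score_poly j) <= j.+1)%N.
Proof.
suff H n : forall j, (j < n)%N ->
    size (score_residual j) = j.+1 /\ (size (score_poly j) <= j.+1)%N.
  exact: (H j.+1).
elim: n => // n IH {}j jn.
have sr : size (score_residual j) = j.+1.
  rewrite /score_residual size_polyDl ?size_polyXn// size_polyN ltnS.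
  apply: (leq_trans (size_sum _ _ _)); apply/bigmax_leqP => i _.
  rewrite (leq_trans (size_scale_leq _ _))//.
  have [//|_ /leq_trans] := IH i; last by apply.
  by rewrite (leq_trans (ltn_ord i)).
by split=> //; rewrite score_polyE (leq_trans (size_scale_leq _ _))// sr.
Qed.

Lemma score_poly0 : score_poly 0 = 1.
Proof.
have r0 : score_residual 0 = 1 by rewrite /score_residual big_ord0 subr0 expr0.
by rewrite score_polyE r0 mulr1 [L 1]score_mean1 sqrtr1 invr1 scale1r.
Qed.

Section Nondegenerate.
Context (ndX : nondegenerate_law X).

Lemma score_norm_gt0 j : lp_index X j ->
  0 < L (score_residual j * score_residual j).
Proof.
move=> ij; have [sr _] := size_score_poly_residual j.
apply: (score_mean_sq_gt0 ndX ij); rewrite ?sr//.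
by rewrite -size_poly_eq0 sr.
Qed.

Lemma lp_index_le i j : (i <= j)%N -> lp_index X j -> lp_index X i.
Proof. by move=> ij jX s /jX; exact: leq_ltn_trans. Qed.

(** Strong induction on [j]. Against an earlier [score_poly i], only the term of index [i] survives
    in the subtracted projection, and it cancels the inner product with ['X^j]. *)
Lemma score_poly_orthonormal_lt j : lp_index X j ->
  L (score_poly j * score_poly j) = 1 /\
  forall i, (i < j)%N -> L (score_poly j * score_poly i) = 0.
Proof.
suff H n : forall j, (j < n)%N -> lp_index X j ->
    L (score_poly j * score_poly j) = 1 /\
    forall i, (i < j)%N -> L (score_poly j * score_poly i) = 0.
  exact: (H j.+1).
elim: n => // n IH {}j; rewrite ltnS => jn jX.
have r0 := score_norm_gt0 jX; split.
  rewrite score_polyE -scalerAl -scalerAr !LZ mulrA -invfM -expr2.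
  by rewrite sqr_sqrtr ?ltW// mulVf// gt_eqF.
move=> i ij; rewrite score_polyE -scalerAl LZ.
suff -> : L (score_residual j * score_poly i) = 0 by rewrite mulr0.
rewrite /score_residual mulrBl LD LN mulr_suml Lsum.
rewrite (bigD1 (Ordinal ij))//= -scalerAl LZ.
have [-> _] := IH i (leq_trans ij jn) (lp_index_le (ltnW ij) jX).
rewrite mulr1 big1 ?addr0 ?subrr// => k ki.
rewrite -scalerAl LZ; have [lik|lki|eki] := ltngtP i k.
- have [_ ->//] := IH k (leq_trans (ltn_ord k) jn)
    (lp_index_le (ltnW (ltn_ord k)) jX).
  by rewrite mulr0.
- have [_ /(_ k lki)] := IH i (leq_trans ij jn) (lp_index_le (ltnW ij) jX).
  by rewrite mulrC => ->; rewrite mulr0.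
- by case/eqP: ki; apply: val_inj.
Qed.

Lemma score_poly_orthonormal i j : lp_index X i -> lp_index X j ->
  L (score_poly i * score_poly j) = (i == j)%:R.
Proof.
move=> iX jX; have [lij|lji|->] := ltngtP i j.
- by rewrite mulrC (score_poly_orthonormal_lt jX).2.
- by rewrite (score_poly_orthonormal_lt iX).2.
- by rewrite (score_poly_orthonormal_lt jX).1.
Qed.

(** Coordinates exist by eliminating the top coefficient with the residual of that degree;
    orthonormality then identifies them as inner products. *)
Lemma score_poly_expansion n (p : {poly R}) :
  (forall j, (j < n)%N -> lp_index X j) -> (size p <= n)%N ->
  p = \sum_(j < n) L (p * score_poly j) *: score_poly j.
Proof.
move=> nX sp.
have [a pE] : exists a : nat -> R, p = \sum_(j < n) a j *: score_poly j.
  elim: n nX p sp => [|n IH] nX p sp.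
    by exists (fun=> 0); rewrite big_ord0; apply/eqP; rewrite -size_poly_eq0 -leqn0.
  have [sr _] := size_score_poly_residual n.
  have r0 := score_norm_gt0 (nX n (ltnSn n)).
  (* The positive norm makes normalization reversible, so a multiple of the residual is a multiple
     of [score_poly n]. *)
  have rQ : score_residual n =
      Num.sqrt (L (score_residual n * score_residual n)) *: score_poly n.
    by rewrite score_polyE scalerA divff ?scale1r// gt_eqF// sqrtr_gt0.
  have lr : (score_residual n)`_n != 0.
    have : lead_coef (score_residual n) != 0.
      by rewrite lead_coef_eq0 -size_poly_eq0 sr.
    by rewrite lead_coefE sr.
  pose c := p`_n / (score_residual n)`_n.
  have [||a aE] := IH _ (p - c *: score_residual n).
  - by move=> j jn; apply: nX; rewrite ltnS ltnW.
  - apply/leq_sizeP => j; rewrite leq_eqVlt => /predU1P[<-|nj].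
      by rewrite coefB coefZ divfK// subrr.
    rewrite coefB coefZ [p`_j]nth_default ?(leq_trans sp)//.
    by rewrite [X in _ * X]nth_default ?sr// mulr0 subrr.
  exists (fun j => if j == n then
    c * Num.sqrt (L (score_residual n * score_residual n)) else a j).
  rewrite big_ord_recr/= eqxx -scalerA -rQ.
  rewrite (eq_bigr (fun j : 'I_n => a j *: score_poly j)).
    by rewrite -aE subrK.
  by move=> j _; rewrite (ltn_eqF (ltn_ord j)).
rewrite {1}pE; apply: eq_bigr => j _; congr (_ *: _).
rewrite pE mulr_suml Lsum (bigD1 j)//= -scalerAl LZ.
have oX (i : 'I_n) := nX i (ltn_ord i).
rewrite (score_poly_orthonormal (oX j) (oX j)) eqxx mulr1 big1 ?addr0// => i ij.
rewrite -scalerAl LZ (score_poly_orthonormal (oX i) (oX j)).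
by rewrite [(i : nat) == j](negbTE ij) mulr0.
Qed.

End Nondegenerate.

End ScorePolynomials.

(** * The representation *)

(** Newton interpolation: a new node is matched by adding a multiple of the product [z], which
    vanishes at the earlier nodes. *)
Lemma poly_interpolation (F : fieldType) (s : seq F) (v : F -> F) : uniq s ->
  exists2 p : {poly F}, (size p <= size s)%N & forall x, x \in s -> p.[x] = v x.
Proof.
elim: s => [|a s IH] /=; first by exists 0; rewrite ?size_poly0.
move=> /andP[as_ us]; have [p sp pv] := IH us.
pose z := \prod_(x <- s) ('X - x%:P).
have za : z.[a] != 0 by rewrite -/(root z a) root_prod_XsubC.
exists (p + ((v a - p.[a]) / z.[a]) *: z).
  rewrite (leq_trans (size_polyD _ _))// geq_max (leq_trans sp)//=.
  by rewrite (leq_trans (size_scale_leq _ _))// size_prod_XsubC.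
move=> x; rewrite inE hornerD hornerZ => /predU1P[->|xs].
  by rewrite divfK// addrC subrK.
have /rootP -> : root z x by rewrite root_prod_XsubC.
by rewrite mulr0 addr0 pv.
Qed.

Section Representation.
Context d (T : measurableType d) (R : realType) (P : probability T R)
  (X Y : {RV P >-> R}) (r : R -> R).
Context (Y1 : P.-integrable [set: T] (fun w => (Y w)%:E))
  (hr : cond_mean X Y r).

Let phi : R -> R := lp_score1 X.
Let L : {poly R} -> R := score_mean X.
Let Q : nat -> {poly R} := score_poly X.
Let c : nat -> R := lp_comoment0 X Y.

Let mr : measurable_fun [set: T] (fun w => r (X w)).
Proof. by case: hr => ? _ _; exact: measurableT_comp. Qed.

Let ir : P.-integrable [set: T] (EFin \o (fun w => r (X w))).
Proof. by case: hr. Qed.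

Let integrable_mul_poly (f : T -> R) (p : {poly R}) :
  P.-integrable [set: T] (EFin \o f) ->
  P.-integrable [set: T] (EFin \o (fun w => f w * p.[phi (X w)])).
Proof.
move=> fi; have [M pM] := horner_score1_bounded X p.
apply: (integrable_mul_bounded (M := M)) => //.
exact: measurable_horner_score1.
Qed.

Let cond_mean_horner (p : {poly R}) :
  \int[P]_w (r (X w) * p.[phi (X w)]) = \int[P]_w (Y w * p.[phi (X w)]).
Proof.
have [M pM] := horner_score1_bounded X p.
apply: (cond_mean_mul_bounded (g := fun x => p.[phi x]) (M := M)) => //.
by apply: measurable_horner; exact: measurable_lp_score1.
Qed.

(** A score function is a polynomial in a bounded function, hence bounded. Both expectations are
    therefore finite, and the identity between real integrals lifts to the extended reals. *)
Lemma lp_coefficients j :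
  ('E_P[fun w => (r (X w) * lp_score X j (X w))%R]
     = 'E_P[fun w => (Y w * lp_score X j (X w))%R])%E
  /\ ('E_P[fun w => (Y w * lp_score X j (X w))%R]
     = (lp_comoment0 X Y j)%:E)%E.
Proof.
have sE (f : T -> R) : (fun w => f w * lp_score X j (X w)) =
    (fun w => f w * (Q j).[phi (X w)]).
  by apply/funext => w; rewrite lp_scoreE.
have fY : ('E_P[fun w => (Y w * lp_score X j (X w))%R])%E \is a fin_num.
  rewrite sE unlock; apply: integrable_fin_num => //.
  exact: integrable_mul_poly Y1.
have fr : ('E_P[fun w => (r (X w) * lp_score X j (X w))%R])%E \is a fin_num.
  rewrite (sE (r \o X)) unlock; apply: integrable_fin_num => //.
  exact: integrable_mul_poly ir.
split; last by rewrite /lp_comoment0 fineK.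
rewrite -(fineK fY) -(fineK fr) (sE (r \o X)) sE; congr EFin.
by rewrite unlock; exact: cond_mean_horner.
Qed.

Let LR (p : {poly R}) : R := \int[P]_w (r (X w) * p.[phi (X w)]).

Let LRD p q : LR (p + q) = LR p + LR q.
Proof.
rewrite -RintegralD//; [|exact: integrable_mul_poly ir..].
by apply: eq_Rintegral => w _; rewrite hornerD mulrDr.
Qed.

Let LRZ a p : LR (a *: p) = a * LR p.
Proof.
rewrite -RintegralZl//; last exact: integrable_mul_poly ir.
by apply: eq_Rintegral => w _; rewrite hornerZ mulrCA.
Qed.

Let LRN p : LR (- p) = - LR p.
Proof. by rewrite -scaleN1r LRZ mulN1r. Qed.

Let LRsum (I : Type) (s : seq I) (F : I -> {poly R}) :
  LR (\sum_(i <- s) F i) = \sum_(i <- s) LR (F i).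
Proof.
elim/big_rec2 : _ => [|i _ y _ <-]; last by rewrite LRD.
by rewrite -(scale0r 0) LRZ mul0r.
Qed.

Let LRQ j : LR (Q j) = c j.
Proof.
rewrite /LR cond_mean_horner /c /lp_comoment0 unlock.
by apply: eq_Rintegral => w _; rewrite lp_scoreE.
Qed.

(** The term of index 0 is the mean, which is why the sums of the representation start at 1. *)
Let mean0 : c 0 = fine ('E_P[Y])%E.
Proof.
rewrite -LRQ /LR cond_mean_horner /Q score_poly0 unlock.
by apply: eq_Rintegral => w _; rewrite hornerC mulr1.
Qed.

Let partial_sum (m : nat) : {poly R} := \sum_(j < m) c j *: Q j.

Let partial_sumE m x : (partial_sum m.+1).[phi x] =
  fine ('E_P[Y])%E + \sum_(1 <= j < m.+1) lp_score X j x * lp_comoment0 X Y j.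
Proof.
rewrite horner_sum -(big_mkord predT (fun j => (c j *: Q j).[phi x])).
rewrite big_ltn// hornerZ mean0 /Q score_poly0 hornerC mulr1; congr (_ + _).
by apply: eq_bigr => j _; rewrite hornerZ lp_scoreE mulrC.
Qed.

(** A point of positive mass cannot lie outside a list that carries all the mass, so the first list
    is contained in the second. *)
Lemma takes_values_size (s s' : seq R) : takes_values X s ->
  takes_values X s' -> (size s <= size s')%N.
Proof.
move=> [us ps _] [_ _ s'1]; apply: uniq_leq_size => // x /ps px.
apply: contraLR px => xs'; rewrite -leNgt.
have mx : measurable (X @^-1` [set x]) by exact: measurable_funPTI.
have ms' : measurable (X @^-1` [set` s']).
  apply: measurable_funPTI.
  exact/countable_measurable/finite_set_countable/finite_seq.
have : P (X @^-1` [set x]) = 0%E.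
  apply/eqP; rewrite eq_le measure_ge0 andbT.
  apply: (@le_trans _ _ (P (~` (X @^-1` [set` s'])))).
    rewrite le_measure ?inE//; first exact: measurableC.
    by move=> w /= ->; exact/negP.
  by rewrite probability_setC// s'1 subee.
by rewrite /pmf => ->.
Qed.

Lemma lp_index_size (s : seq R) j : takes_values X s -> (j < size s)%N ->
  lp_index X j.
Proof. by move=> sX js s' s'X; rewrite (leq_trans js)// takes_values_size. Qed.

Context (ndX : nondegenerate_law X).

(** The first score function separates the points of [s], so on them [r] is a polynomial in it, of
    size at most [size s]. The orthonormal expansion of that polynomial is finite and has the
    comoments as coordinates. *)
Lemma lp_finite_representation (s : seq R) x : takes_values X s -> x \in s ->
  r x - fine ('E_P[Y])%E
  = \sum_(1 <= j < size s) lp_score X j x * lp_comoment0 X Y j.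
Proof.
move=> sX xs; have [us ps s1] := sX.
have phi_inj : {in s &, injective phi}.
  move=> y z /ps py /ps pz /(congr1 ( *%R^~ (mid_sd X))).
  rewrite /phi /lp_score1 !divfK ?gt_eqF ?mid_sd_gt0// => /addIr.
  by apply: mid_cdf_inj; exact: pmf_gt0_not_flat.
have us' : uniq (map phi s) by rewrite map_inj_in_uniq.
(* The function [r] read through the inverse of [phi] on the nodes; the default 0 is not reached
   there. *)
pose v u := r (nth 0 s (index u (map phi s))).
have [p sp pv] := poly_interpolation v us'.
have pr y : y \in s -> p.[phi y] = r y.
  by move=> ys; rewrite pv ?map_f// /v nth_index_map.
have mXs : measurable (X @^-1` [set` s]).
  apply: measurable_funPTI.
  exact/countable_measurable/finite_set_countable/finite_seq.
(* Almost surely [X] lies in [s], where [r] and the interpolant agree. *)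
have LRp q : LR q = L (p * q).
  congr fine; apply: ae_eq_integral => //.
  - by have /integrableP[] := integrable_mul_poly q ir.
  - by have /integrableP[] := integrable_horner_score1 X (p * q).
  - exists (~` (X @^-1` [set` s])); split; first exact: measurableC.
      by have := probability_setC P mXs; rewrite s1 subee.
    move=> w /= nw Xs; apply: nw => _.
    by rewrite hornerM pr.
have pE : p = partial_sum (size s).
  rewrite {1}(@score_poly_expansion _ _ _ P X ndX (size s) p).
  - by apply: eq_bigr => j _; rewrite -[c j]LRQ LRp.
  - by move=> j; exact: lp_index_size.
  - by rewrite (leq_trans sp)// size_map.
have s0 : (0 < size s)%N by case: (s) xs.
by rewrite -(pr x xs) pE -(prednK s0) partial_sumE addrC addKr.
Qed.

(** * Infinitely many values: convergence in mean square and at atoms *)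

Section MeanSquare.
Context (infX : forall s : seq R, ~ takes_values X s)
  (ir2 : P.-integrable [set: T] (fun w => (r (X w) ^+ 2)%:E)).

Let err (p : {poly R}) : R := \int[P]_w ((r (X w) - p.[phi (X w)]) ^+ 2).

Let integrable_err (p : {poly R}) : P.-integrable [set: T]
  (EFin \o (fun w => (r (X w) - p.[phi (X w)]) ^+ 2)) /\
  err p = \int[P]_w (r (X w) ^+ 2) - 2 * LR p + L (p * p).
Proof.
have i1 : P.-integrable [set: T] (EFin \o (fun w => 2 * (r (X w) * p.[phi (X w)]))).
  have := integrableZl measurableT 2 (integrable_mul_poly p ir).
  by apply: eq_integrable => // w _; rewrite /= EFinM.
have i2 : P.-integrable [set: T]
    (EFin \o (fun w => r (X w) ^+ 2 - 2 * (r (X w) * p.[phi (X w)]))).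
  exact: integrableB ir2 i1.
have i3 := integrable_horner_score1 X (p * p).
have E w : (r (X w) - p.[phi (X w)]) ^+ 2 =
    r (X w) ^+ 2 - 2 * (r (X w) * p.[phi (X w)]) + (p * p).[phi (X w)].
  by rewrite hornerM; ring.
split.
  have := integrableD measurableT i2 i3.
  by apply: eq_integrable => // w _; rewrite /= E EFinD.
rewrite /LR -RintegralZl//; last exact: integrable_mul_poly ir.
rewrite -RintegralB// -RintegralD//.
by apply: eq_Rintegral => w _; rewrite E.
Qed.

Let errE (p : {poly R}) : sq_dist X r (fun x => p.[phi x]) = (err p)%:E.
Proof.
by rewrite /err fineK//; apply: integrable_fin_num => //; exact: (integrable_err p).1.
Qed.

Let indexX j : lp_index X j.
Proof. by move=> s /infX. Qed.

(* Orthogonality of the residual [r - partial_sum m] to the polynomials of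
   size at most [m]. *)
Let LR_partial_sum m (u : {poly R}) : (size u <= m)%N ->
  LR u = L (partial_sum m * u).
Proof.
move=> um; rewrite {1}(score_poly_expansion ndX (fun j _ => indexX j) um).
rewrite LRsum mulr_suml /L score_mean_sum; apply: eq_bigr => j _.
by rewrite LRZ LRQ -scalerAl score_meanZ mulrC [u * _]mulrC.
Qed.

(** Best approximation: with [p = S + u], orthogonality removes the cross term, and the error of [p]
    exceeds that of [S] by the mean of the square of [u]. *)
Let err_le m (p : {poly R}) : (size p <= m)%N -> err (partial_sum m) <= err p.
Proof.
move=> pm; set S := partial_sum m.
have sS : (size S <= m)%N.
  apply: (leq_trans (size_sum _ _ _)); apply/bigmax_leqP => i _.
  rewrite (leq_trans (size_scale_leq _ _))//.
  by rewrite (leq_trans (size_score_poly_residual X i).2).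
have [u uE um] : exists2 u, p = S + u & (size u <= m)%N.
  exists (p - S); first by rewrite addrC subrK.
  by rewrite (leq_trans (size_polyD _ _))// size_polyN geq_max pm.
rewrite (integrable_err S).2 (integrable_err p).2 uE LRD (LR_partial_sum um) -/S.
rewrite (_ : (S + u) * (S + u) = S * S + (S * u + S * u) + u * u); last by ring.
by rewrite /L !score_meanD; have := score_mean_sq_ge0 X u; lra.
Qed.

(** Density gives one polynomial with error at most [e]; by minimality, every partial sum with at
    least as many terms as its size does as well. *)
Lemma lp_mean_square_cvg : err (partial_sum m.+1) @[m --> \oo] --> (0 : R).
Proof.
apply/cvgr0Pnorm_le => e e0.
have [p pe] := poly_approximable_L2 (measurable_lp_score1 X)
  (ray_approximable ndX) (let: And3 mr _ _ := hr in mr) ir2 e0.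
move: pe; rewrite errE lee_fin => pe; near=> m.
rewrite ger0_norm; last by apply: Rintegral_ge0 => w _; rewrite sqr_ge0.
apply: (le_trans _ pe); apply: err_le; rewrite leqW//.
by near: m; exact: nbhs_infty_ge.
Unshelve. all: by end_near. Qed.

Lemma lp_mean_square_representation :
  (('E_P[fun w => ((r (X w) - fine ('E_P[Y])%E
        - \sum_(1 <= j < m.+1)
             lp_score X j (X w) * lp_comoment0 X Y j) ^+ 2)%R])%E
     @[m --> \oo] --> (0 : \bar R)%E).
Proof.
rewrite (_ : (fun m => _) = (fun m => (err (partial_sum m.+1))%:E)).
  apply: cvg_EFin; first exact: nearW.
  exact: lp_mean_square_cvg.
apply/funext => m; rewrite -errE.
transitivity ('E_P[fun w => ((r (X w) - (partial_sum m.+1).[phi (X w)]) ^+ 2)%R])%E.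
  by congr expectation; apply/funext => w; rewrite partial_sumE opprD addrA.
by rewrite unlock.
Qed.

(** The squared error at an atom, weighted by its mass, is at most the whole mean-square error, so
    mean-square convergence forces convergence there. *)
Lemma lp_pointwise_representation x : 0 < pmf X x ->
  (\sum_(1 <= j < m.+1) lp_score X j x * lp_comoment0 X Y j)
    @[m --> \oo] --> r x - fine ('E_P[Y])%E.
Proof.
move=> px.
have mx : measurable (X @^-1` [set x]) by exact: measurable_funPTI.
have le m : (r x - (partial_sum m.+1).[phi x]) ^+ 2 <=
    (pmf X x)^-1 * err (partial_sum m.+1).
  set q := partial_sum _; rewrite mulrC ler_pdivlMr//.
  set a := (r x - q.[phi x]) ^+ 2.
  have E : \int[P]_w (a * \1_(X @^-1` [set x]) w) = a * pmf X x.
    rewrite RintegralZl//; last exact: integrable_indic.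
    by rewrite /Rintegral integral_indic// setIT.
  rewrite -E; apply: le_Rintegral => //.
  - have := integrableZl measurableT a (integrable_indic P mx).
    by apply: eq_integrable => // w _; rewrite /= EFinM.
  - exact: (integrable_err q).1.
  - move=> w _; rewrite indicE; case: (boolP (w \in _)) => Xw.
      by rewrite mulr1 /a; move: Xw; rewrite inE /= => ->.
    by rewrite mulr0 sqr_ge0.
have sq0 : (r x - (partial_sum m.+1).[phi x]) ^+ 2 @[m --> \oo] --> (0 : R).
  apply: (@squeeze_cvgr _ _ _ _ (cst 0)
    (fun m => (pmf X x)^-1 * err (partial_sum m.+1))).
  - by apply: nearW => m; rewrite sqr_ge0 le.
  - exact: cvg_cst.
  - rewrite -(mulr0 (pmf X x)^-1).
    by apply: cvgMr; exact: lp_mean_square_cvg.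
apply/cvgrPdist_le => e e0.
have sq_le (z : R) : z ^+ 2 <= e ^+ 2 -> `|z| <= e.
  by rewrite -real_normK ?num_real// ler_pXn2r ?nnegrE// ltW.
have e20 : 0 < e ^+ 2 by rewrite exprn_gt0.
move/cvgr0Pnorm_le : sq0 => /(_ _ e20); apply: filterS => m.
rewrite ger0_norm ?sqr_ge0// partial_sumE opprD addrA.
exact: sq_le.
Qed.

End MeanSquare.

End Representation.

Theorem theorem10 (d : measure_display) (T : measurableType d) (R : realType)
    (P : probability T R) (X Y : {RV P >-> R})
    (hX : discrete_law X \/ continuous_law X)
    (hY : discrete_law Y \/ continuous_law Y)
    (ndX : nondegenerate_law X)
    (Y1 : P.-integrable [set: T] (fun w => (Y w)%:E))
    (r : R -> R) (hr : cond_mean X Y r) :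
  [/\ (* the coefficients *)
      forall j : nat, (0 < j)%N -> lp_index X j ->
        ('E_P[fun w => (r (X w) * lp_score X j (X w))%R]
           = 'E_P[fun w => (Y w * lp_score X j (X w))%R])%E
        /\ ('E_P[fun w => (Y w * lp_score X j (X w))%R]
           = (lp_comoment0 X Y j)%:E)%E,
      (* the representation, when X takes finitely many values *)
      forall (s : seq R), takes_values X s ->
        forall x : R, x \in s ->
          r x - fine ('E_P[Y])%E
          = \sum_(1 <= j < size s) lp_score X j x * lp_comoment0 X Y j
    & (* the representation, when X takes infinitely many values:
         in mean square, and at every value of positive probability *)
      (forall s : seq R, ~ takes_values X s) ->
      P.-integrable [set: T] (fun w => (r (X w) ^+ 2)%:E) ->
        (('E_P[fun w => ((r (X w) - fine ('E_P[Y])%E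
              - \sum_(1 <= j < m.+1)
                   lp_score X j (X w) * lp_comoment0 X Y j) ^+ 2)%R])%E
           @[m --> \oo] --> (0 : \bar R)%E)
        /\ (forall x : R, 0 < pmf X x ->
             (\sum_(1 <= j < m.+1) lp_score X j x * lp_comoment0 X Y j)
               @[m --> \oo] --> r x - fine ('E_P[Y])%E)].
Proof.
split.
- by move=> j _ _; exact: lp_coefficients.
- by move=> s sX x xs; exact: lp_finite_representation.
- move=> infX r2; split; first exact: lp_mean_square_representation.
  by move=> x px; exact: lp_pointwise_representation.
Qed.
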